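(* Let $k\ge 1$ be an integer, let $\lambda_1,\dots,\lambda_k>0$, and let $\{M(t)\}_{t\ge0}$ be the generalized counting process (GCP) with rates $\lambda_1,\dots,\lambda_k$. Then $$\lim_{t\to\infty}\frac{M(t)}{t}=\sum_{j=1}^{k}j\lambda_{j}\quad\text{in probability}.$$
   Context: The generalized counting process (GCP) $\{M(t)\}_{t\ge0}$ with rates $\lambda_1,\dots,\lambda_k>0$ is the counting process started at $0$ performing jumps of sizes $1,\dots,k$ with rates $\lambda_1,\dots,\lambda_k$ respectively. It is a compound Poisson process (in particular a Lévy process): $M(t)\overset{d}{=}\sum_{i=1}^{N(t)}X_i$, where $\{N(t)\}_{t\ge0}$ is a Poisson process with intensity $\Lambda=\lambda_1+\dots+\lambda_k$ independent of the iid sequence $\{X_i\}_{i\ge1}$ with $\mathrm{Pr}\{X_1=j\}=\lambda_j/\Lambda$, $j=1,\dots,k$. *)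

(* Defs.v *)
From HB Require Import structures.
From mathcomp Require Import all_boot all_order all_algebra.
From mathcomp Require Import all_classical all_reals all_analysis.

Set Implicit Arguments.
Unset Strict Implicit.
Unset Printing Implicit Defensive.
Import Order.TTheory GRing.Theory Num.Theory.
Import numFieldNormedType.Exports.

Local Open Scope classical_set_scope.
Local Open Scope ring_scope.

Definition nat_process (R : realType) (d : measure_display)
    (T : measurableType d) (P : probability T R) : Type :=
  R -> {RV P >-> nat}.

Definition counting_path (R : realType) (f : R -> nat) : Prop :=
  [/\ f 0 = 0%N,
      forall s t : R, 0 <= s -> s <= t -> (f s <= f t)%N &
      forall t : R, 0 <= t -> \forall s \near t^'+, f s = f t].

(* The truncated subtraction on nat is harmless: it is only used for s <= t
   and processes whose paths are almost surely nondecreasing. *)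
Definition increment (R : realType) (T : Type) (M : R -> T -> nat)
    (s t : R) : T -> nat :=
  fun w => (M t w - M s w)%N.

(* The product rule for subfamilies is the case A i = setT for the other i. *)
Definition mutually_independent (R : realType) (d : measure_display)
    (T : measurableType d) (P : probability T R) (n : nat)
    (X : 'I_n -> T -> nat) : Prop :=
  forall A : 'I_n -> set nat,
    P [set w | forall i, A i (X i w)] = (\prod_(i < n) P (X i @^-1` A i))%E.

Definition independent_increments (R : realType) (d : measure_display)
    (T : measurableType d) (P : probability T R) (M : nat_process P) : Prop :=
  forall (n : nat) (t : nat -> R), 0 <= t 0%N ->
    (forall i, (i < n)%N -> t i <= t i.+1) ->
    mutually_independent P (fun i : 'I_n => increment M (t i) (t i.+1)).

Definition stationary_increments (R : realType) (d : measure_display)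
    (T : measurableType d) (P : probability T R) (M : nat_process P) : Prop :=
  forall (s h : R) (A : set nat), 0 <= s -> 0 <= h ->
    P (increment M s (s + h) @^-1` A) = P (increment M 0 h @^-1` A).

(* lam i is the rate of the jumps of size i + 1. In every time interval
   (t, t + h], a jump of size j occurs with probability lambda_j h + o(h), and
   a total displacement larger than k has probability o(h), as h -> 0+. *)
Definition jump_rates (R : realType) (d : measure_display)
    (T : measurableType d) (P : probability T R) (k : nat) (lam : 'I_k -> R)
    (M : nat_process P) : Prop :=
  forall t : R, 0 <= t ->
    (forall i : 'I_k,
      (fun h : R => fine (P [set w | increment M t (t + h) w = i.+1])
                    - lam i * h) =o_ (0^'+) id) /\
    (fun h : R => fine (P [set w | (k < increment M t (t + h) w)%N]))
      =o_ (0^'+) id.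

(* These axioms determine the finite-dimensional distributions of M: it is the
   compound Poisson process of intensity \sum_i lam i whose jumps have size
   i + 1 with probability lam i / \sum_i lam i. *)
Record generalized_counting_process (R : realType) (d : measure_display)
    (T : measurableType d) (P : probability T R) (k : nat) (lam : 'I_k -> R)
    (M : nat_process P) : Prop := {
  gcp_paths : {ae P, forall w, counting_path (fun t => M t w)} ;
  gcp_independent : independent_increments M ;
  gcp_stationary : stationary_increments M ;
  gcp_rates : jump_rates lam M
}.

Definition cvg_in_probability (R : realType) (d : measure_display)
    (T : measurableType d) (P : probability T R) (X : R -> T -> R) (l : R) :
    Prop :=
  forall eps : R, 0 < eps ->
    P [set w | eps <= `|X t w - l|] @[t --> +oo] --> 0%E.

(* Main.v *)
Require Import Defs.
From HB Require Import structures.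
From mathcomp Require Import all_boot all_order all_algebra.
From mathcomp Require Import all_classical all_reals all_analysis.
From mathcomp Require Import measurable_realfun ring lra.
Import Order.TTheory GRing.Theory Num.Theory.
Import numFieldNormedType.Exports.
Local Open Scope classical_set_scope.
Local Open Scope ring_scope.

(** The proof works with generating functions, which integrate only bounded
functions of M t. For 0 <= u <= 1, stationarity and independence of the increments
make f t = E[u ^ (M t - M 0)] multiplicative: f (s + t) = f s * f t
([gcp_pgfD]). The jump rates give its slope at the origin, which is
- psi u with psi u = \sum_j lam_j (1 - u ^ j) ([gcp_pgf_slope]): jumps above k
contribute at most their probability o(h), because |1 - u ^ n| <= 1. A
multiplicative function with a slope at 0 is an exponential
([semigroup_expR]), hence E[u ^ M t] = exp (- t psi u) ([gcp_pgfE]).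

Taking u = exp (- a / t) turns this into the Laplace transform of M t / t at a,
and t (1 - exp (- a j / t)) --> a j shows that it tends to exp (- a mu), where
mu = \sum_j j lam_j ([gcp_laplace_cvg]). Only a = 1 and a = 2 are needed: with
Y = exp (- M t / t), E[Y] --> exp (- mu) and E[Y ^ 2] --> exp (- 2 mu) say that
E[(Y - exp (- mu)) ^ 2] --> 0. As M t / t can be eps-far from mu only if Y is
far from exp (- mu) ([expRN_dist]), Chebyshev's inequality for Y
([chebyshev_laplace]) bounds the probability of both deviations of M t / t at
once. *)

(** * Limits involving the exponential *)

(** The lower bound is 1 + y <= exp y at y = - x / (1 + x), inverted. *)
Lemma expR_sandwich1D (R : realType) (x : R) : -1 < x ->
  expR (x / (1 + x)) <= 1 + x <= expR x.
Proof.
move=> x_gtN1; have x1_gt0 : 0 < 1 + x by lra.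
rewrite expR_ge1Dx andbT -[leRHS]invrK -[leLHS]invrK -expRN.
rewrite lef_pV2 ?posrE ?invr_gt0 ?expR_gt0//.
apply: le_trans (expR_ge1Dx _); rewrite le_eqVlt; apply/orP; left.
by apply/eqP; field; rewrite gt_eqF.
Qed.

Lemma expRN_slope_sandwich (R : realType) (x : R) : 0 <= x ->
  x / (1 + x) <= 1 - expR (- x) <= x.
Proof.
move=> x_ge0; have x1_gt0 : 0 < 1 + x by lra.
have := expR_ge1Dx (- x); have := expR_ge1Dx x => ex eNx.
apply/andP; split; last lra.
rewrite expRN; have : (expR x)^-1 <= (1 + x)^-1.
  by rewrite lef_pV2 ?posrE ?expR_gt0.
have -> : x / (1 + x) = 1 - (1 + x)^-1 by field; rewrite gt_eqF.
lra.
Qed.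

Lemma cvg_expRN_slope (R : realType) (a : R) : 0 <= a ->
  t * (1 - expR (- (a / t))) @[t --> +oo] --> a.
Proof.
move=> a_ge0.
have inv0 : a / t @[t --> +oo] --> (0 : R).
  rewrite -[X in _ --> X](mulr0 a); apply: cvgM; first exact: cvg_cst.
  apply: (gtr0_cvgV0 _).2; last exact: cvg_id.
  by near=> t; near: t; exact: nbhs_pinfty_gt.
have lim_lo : a / (1 + a / t) @[t --> +oo] --> a.
  suff : a / (1 + a / t) @[t --> +oo] --> a / (1 + 0) by rewrite addr0 divr1.
  apply: cvgM; first exact: cvg_cst.
  apply: cvgV; first by rewrite addr0 oner_eq0.
  by apply: cvgD => //; exact: cvg_cst.
apply: squeeze_cvgr lim_lo (cvg_cst a).
near=> t.
have t_gt0 : 0 < t by near: t; exact: nbhs_pinfty_gt.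
have tE : t * (a / t) = a by rewrite mulrCA divff ?mulr1// gt_eqF.
have /expRN_slope_sandwich/andP[lo up] : 0 <= a / t by rewrite divr_ge0// ltW.
rewrite -(ler_pM2l t_gt0) mulrA tE in lo.
by rewrite -(ler_pM2l t_gt0) tE in up; apply/andP.
Unshelve. all: by end_near. Qed.

(** Writing f t = f (t / n) ^ n and f h = 1 + h (slope at h), the sandwich of
[expR_sandwich1D] raised to the power n squeezes f t between two exponentials
that both tend to exp (c t). *)
Lemma semigroup_expR (R : realType) (f : R -> R) (c : R) :
  (forall s t, 0 <= s -> 0 <= t -> f (s + t) = f s * f t) ->
  (f h - 1) / h @[h --> 0^'+] --> c ->
  forall t, 0 < t -> f t = expR (c * t).
Proof.
move=> fD fslope t t_gt0.
have fX n h : 0 <= h -> f (h * n.+1%:R) = f h ^+ n.+1.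
  move=> h_ge0; elim: n => [|n IHn]; first by rewrite mulr1.
  by rewrite -natr1 mulrDr mulr1 fD ?mulr_ge0 ?ler0n// IHn [RHS]exprSr.
pose slope h := (f h - 1) / h; pose base h := 1 + h * slope h.
have h0 : (fun h : R => h) @ (0 : R)^'+ --> (0 : R).
  by apply: cvg_at_right_filter; exact: cvg_id.
have base1 : base h @[h --> 0^'+] --> (1 : R).
  suff : base h @[h --> 0^'+] --> 1 + 0 * c by rewrite mul0r addr0.
  by apply: cvgD; [exact: cvg_cst|exact: (cvgM h0 fslope)].
have up : expR (slope h * t) @[h --> 0^'+] --> expR (c * t).
  apply: continuous_cvg; first exact: continuous_expR.
  by apply: cvgM => //; exact: cvg_cst.
have lo : expR (slope h / base h * t) @[h --> 0^'+] --> expR (c * t).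
  apply: continuous_cvg; first exact: continuous_expR.
  apply: cvgM; last exact: cvg_cst.
  rewrite -[X in _ --> X]divr1.
  by apply: cvgM => //; apply: cvgV => //; exact: oner_neq0.
pose u n := t / n.+1%:R.
have steps : (forall n, u n > 0) /\ u n @[n --> \oo] --> (0 : R).
  split=> [n|]; first exact: divr_gt0.
  rewrite -[X in _ --> X](mulr0 t); apply: cvgM; first exact: cvg_cst.
  exact: cvg_harmonic.
have upu := (cvg_at_rightP _ _ _).1 up _ steps.
have lou := (cvg_at_rightP _ _ _).1 lo _ steps.
have baseu := (cvg_at_rightP _ _ _).1 base1 _ steps.
(* f t does not depend on n, so the squeeze determines it. *)
suff : cst (f t) @ \oo --> expR (c * t).
  by move=> /cvg_lim <-//; rewrite lim_cst.
apply: squeeze_cvgr lou upu; near=> n => /=.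
have u_gt0 : 0 < u n by exact: steps.1.
have b_gt0 : 0 < base (u n).
  by near: n; apply: cvgr_gt baseu _ _; exact: ltr01.
have bE : base (u n) = f (u n) by rewrite /base mulrC divfK ?gt_eqF// addrC subrK.
have tE : t = u n * n.+1%:R by rewrite divfK// pnatr_eq0.
have ftE : f t = base (u n) ^+ n.+1 by rewrite bE -fX ?ltW// -tE.
have /expR_sandwich1D/andP[elo eup] : -1 < u n * slope (u n).
  by rewrite /base in b_gt0; lra.
have -> : slope (u n) / base (u n) * t =
    u n * slope (u n) / (1 + u n * slope (u n)) * n.+1%:R.
  by rewrite [in LHS]tE -/(base _); ring.
have -> : slope (u n) * t = u n * slope (u n) * n.+1%:R by rewrite [in LHS]tE; ring.
rewrite ftE !(expRM_natr n.+1); apply/andP.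
by split; rewrite lerXn2r ?nnegrE ?expR_ge0// ltW.
Unshelve. all: by end_near. Qed.

Lemma littleo_right_cvg (R : realType) (f : R -> R) :
  f =o_ (0^'+) id -> f h / h @[h --> 0^'+] --> (0 : R).
Proof.
move=> fo.
have /eqoP fe : f =o_ (0^'+) (id : R -> R) by exact: fo.
apply/cvgr0Pnorm_le => e e0.
near=> h.
have h0 : 0 < h by near: h; exact: nbhs_right_gt.
rewrite normrM normfV ler_pdivrMr ?normr_gt0 ?gt_eqF//.
by near: h; exact: (fe _ e0).
Unshelve. all: by end_near. Qed.

(** As exp (- x) is convex, the smaller displacement is the one for x above mu:
1 - exp (- eps) <= exp eps - 1, so its bound serves for both sides. *)
Lemma expRN_dist (R : realType) (x mu eps : R) : 0 < eps ->
  eps <= `|x - mu| ->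
  expR (- mu) * (1 - expR (- eps)) <= `|expR (- x) - expR (- mu)|.
Proof.
move=> eps0 dev; have em0 := expR_gt0 (- mu); move: dev.
have -> : expR (- x) - expR (- mu) = expR (- mu) * (expR (- (x - mu)) - 1).
  by rewrite mulrBr mulr1 -expRD; congr (expR _ - _); ring.
rewrite normrM (gtr0_norm em0) ler_pM2l//.
have [xm|xm] := leP mu x.
  have xm0 : 0 <= x - mu by rewrite subr_ge0.
  rewrite (ger0_norm xm0) => ex.
  rewrite distrC (le_trans _ (ler_norm _))// lerB// ler_expR; lra.
have xm0 : x - mu < 0 by rewrite subr_lt0.
rewrite (ltr0_norm xm0) => ex.
rewrite (le_trans _ (ler_norm _))//.
have : expR eps <= expR (- (x - mu)) by rewrite ler_expR; lra.
have := expR_ge1Dx eps; have := expR_ge1Dx (- eps); lra.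
Qed.

(** * Expectations of functions of nat-valued random variables *)

Section nat_random_variables.
Context (R : realType) (d : measure_display) (T : measurableType d).
Context (P : probability T R).
Implicit Types (X Y : T -> nat) (g h : nat -> R).

Lemma measurable_nat_comp d' (U : measurableType d') X (g : nat -> U) :
  measurable_fun setT X -> measurable_fun setT (fun w => g (X w)).
Proof. by move=> mX; exact: (@measurableT_comp _ _ _ _ _ _ g). Qed.

Lemma measurable_nat_preimage X (A : set nat) :
  measurable_fun setT X -> measurable (X @^-1` A).
Proof. by move=> mX; rewrite -[X in measurable X]setTI; exact: mX. Qed.

(** The value of M s ranges over a countable set; on each of its fibers the
increment is a function of M t alone. *)
Lemma measurable_increment (M : R -> T -> nat) s t :
  measurable_fun setT (M s) -> measurable_fun setT (M t) ->
  measurable_fun setT (increment M s t).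
Proof.
move=> ms mt _ A _; rewrite setTI.
rewrite [X in measurable X](_ : _ = \bigcup_n (M s @^-1` [set n] `&`
    M t @^-1` [set m | A (m - n)%N])); last first.
  apply/seteqP; split => [w Aw|w [n _ [/= <-]]]; last by [].
  by exists (M s w).
by apply: bigcup_measurable => n _; apply: measurableI;
  exact: measurable_nat_preimage.
Qed.

Lemma Rintegral_ae_eq (f g : T -> R) :
  measurable_fun setT f -> measurable_fun setT g ->
  {ae P, forall w, f w = g w} -> \int[P]_w f w = \int[P]_w g w.
Proof.
move=> mf mg fg; rewrite /Rintegral; congr fine; apply: ae_eq_integral => //.
- exact/measurable_EFinP.
- exact/measurable_EFinP.
- by apply: filterS fg => w fgw _; rewrite fgw.
Qed.

Lemma integrable_nat_comp X g (C : R) : measurable_fun setT X ->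
  (forall n, `|g n| <= C) -> P.-integrable setT (EFin \o (fun w => g (X w))).
Proof.
move=> mX gC; apply: measurable_bounded_integrable => //.
- exact: fin_num_fun_lty.
- exact: measurable_nat_comp.
- by exists C; split; [exact: num_real|move=> y Cy w _; exact/(le_trans (gC _))/ltW].
Qed.

(** Conditioning on the value of X. The extra factor h is what allows the lemma
to be applied to two random variables in turn. *)
Lemma integral_nat_series X g (h : T -> \bar R) :
  measurable_fun setT X -> (forall n, 0 <= g n) ->
  measurable_fun setT h -> (forall w, 0 <= h w)%E ->
  (\int[P]_w ((g (X w))%:E * h w) =
   \sum_(n <oo) (g n)%:E * \int[P]_w ((\1_(X @^-1` [set n]) w)%:E * h w))%E.
Proof.
move=> mX g0 mh h0.
have mind n : measurable_fun setT
    (fun w => (\1_(X @^-1` [set n]) w)%:E * h w : \bar R)%E.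
  apply: emeasurable_funM => //; apply/measurable_EFinP.
  by apply: measurable_indic; exact: measurable_nat_preimage.
have ind0 n w : (0 <= (\1_(X @^-1` [set n]) w)%:E * h w :> \bar R)%E.
  by rewrite mule_ge0// lee_fin.
under [RHS]eq_eseriesr => n _.
  rewrite -ge0_integralZl//; last by rewrite lee_fin.
  over.
rewrite -integral_nneseries//; last 2 first.
- by move=> n; apply: emeasurable_funM => //; exact: measurable_cst.
- by move=> n w _; rewrite mule_ge0// lee_fin.
apply: eq_integral => w _.
rewrite (@nneseriesD1 _ _ (X w))//; last by move=> n _; rewrite mule_ge0// lee_fin.
rewrite eseries0 ?adde0.
  by rewrite indicE mem_set// mul1e.
move=> n _ /andP[_ nX]; rewrite indicE memNset ?mul0e ?mule0//= => Xn.
by rewrite -Xn eqxx in nX.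
Qed.

Lemma integral_nat_law X g :
  measurable_fun setT X -> (forall n, 0 <= g n) ->
  (\int[P]_w (g (X w))%:E = \sum_(n <oo) (g n)%:E * P (X @^-1` [set n]))%E.
Proof.
move=> mX g0; under eq_integral do rewrite -[(g _)%:E]mule1.
rewrite (integral_nat_series _ _ (cst 1%E))//; apply: eq_eseriesr => n _.
congr (_ * _)%E; under eq_integral do rewrite mule1.
by rewrite integral_indic ?setIT//; exact: measurable_nat_preimage.
Qed.

Lemma Rintegral_eq_law X Y g :
  measurable_fun setT X -> measurable_fun setT Y -> (forall n, 0 <= g n) ->
  (forall A, P (X @^-1` A) = P (Y @^-1` A)) ->
  \int[P]_w g (X w) = \int[P]_w g (Y w).
Proof.
move=> mX mY g0 XY; rewrite /Rintegral !integral_nat_law//; congr fine.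
by apply: eq_eseriesr => n _; rewrite XY.
Qed.

Lemma integral_indicM_independent (E : set T) Y h :
  measurable E -> measurable_fun setT Y -> (forall n, 0 <= h n) ->
  (forall B, P (E `&` Y @^-1` B) = P E * P (Y @^-1` B))%E ->
  (\int[P]_w ((\1_E w)%:E * (h (Y w))%:E) = P E * \int[P]_w (h (Y w))%:E)%E.
Proof.
move=> mE mY h0 EY; rewrite integral_nat_law//.
have PE : P E = (fine (P E))%:E by rewrite fineK// fin_num_measure.
rewrite PE -nneseriesZl; last by move=> n _; rewrite mule_ge0// lee_fin.
rewrite -PE; under eq_integral do rewrite muleC.
rewrite integral_nat_series//; last first.
  by apply/measurable_EFinP; exact: measurable_indic.
apply: eq_eseriesr => n _; rewrite muleCA; congr (_ * _)%E.
have mYn : measurable (Y @^-1` [set n]) by exact: measurable_nat_preimage.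
under eq_integral => w _.
  rewrite muleC -EFinM -[_ * _ in X in X%:E]/((\1_E \* \1_(Y @^-1` [set n])) w).
  rewrite -indicI; over.
by rewrite integral_indic ?setIT ?EY//; [exact: EY|exact: measurableI].
Qed.

(** Expand along the values of X, pull out the independent event X = n from
each term, and sum the series back. The bound C only makes the expectations
finite. *)
Lemma Rintegral_independentM X Y g h (C : R) :
  measurable_fun setT X -> measurable_fun setT Y ->
  (forall n, 0 <= g n <= C) -> (forall n, 0 <= h n <= C) ->
  (forall A B, P (X @^-1` A `&` Y @^-1` B) = P (X @^-1` A) * P (Y @^-1` B))%E ->
  \int[P]_w (g (X w) * h (Y w)) = \int[P]_w g (X w) * \int[P]_w h (Y w).
Proof.
move=> mX mY gC hC XY; rewrite /Rintegral.
have fin (Z : T -> nat) (f : nat -> R) :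
    measurable_fun setT Z -> (forall n, 0 <= f n <= C) ->
    (\int[P]_w (f (Z w))%:E)%E \is a fin_num.
  move=> mZ fC; apply: (@integrable_fin_num _ _ _ P setT measurableT).
  apply: (@integrable_nat_comp Z f C mZ) => n.
  by have /andP[f0 fC'] := fC n; rewrite ger0_norm.
rewrite -fineM ?fin//; congr fine.
have g0 n : 0 <= g n by have /andP[] := gC n.
have h0 n : 0 <= h n by have /andP[] := hC n.
under eq_integral do rewrite EFinM.
have mhY : measurable_fun setT (fun w => (h (Y w))%:E).
  by apply/measurable_EFinP; exact: measurable_nat_comp.
rewrite integral_nat_series//; last by move=> w; rewrite lee_fin.
rewrite integral_nat_law// muleC -[X in (X * _)%E]fineK ?fin// -nneseriesZl; last first.
  by move=> n _; rewrite mule_ge0// lee_fin.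
apply: eq_eseriesr => n _; rewrite fineK ?fin// integral_indicM_independent//.
  by rewrite muleA muleC.
exact: measurable_nat_preimage.
Qed.

End nat_random_variables.

(** * Generating functions of nat-valued random variables *)

Section generating_function.
Context (R : realType) (d : measure_display) (T : measurableType d).
Context (P : probability T R).
Implicit Types X : T -> nat.

Lemma integrable_expX X (u : R) : measurable_fun setT X -> 0 <= u <= 1 ->
  P.-integrable setT (EFin \o (fun w => u ^+ X w)).
Proof.
move=> mX /andP[u0 u1]; apply: (@integrable_nat_comp _ _ _ P X _ 1 mX) => n.
by rewrite ger0_norm ?exprn_ge0// exprn_ile1.
Qed.

Lemma integrable_indic_nat X (A : set nat) : measurable_fun setT X ->
  P.-integrable setT (EFin \o (fun w => \1_A (X w) : R)).
Proof.
move=> mX; apply: (@integrable_nat_comp _ _ _ P X _ 1 mX) => n.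
by rewrite indicE; case: (n \in A); rewrite ?normr1// normr0.
Qed.

Lemma Rintegral_indic_nat X (A : set nat) : measurable_fun setT X ->
  \int[P]_w (\1_A (X w) : R) = fine (P (X @^-1` A)).
Proof.
move=> mX; rewrite /Rintegral; congr fine.
have mA : measurable (X @^-1` A) by exact: measurable_nat_preimage.
by rewrite -[X in _ = P X]setIT -integral_indic ?setIT//.
Qed.

Lemma Rintegral1 : \int[P]_w (1 : R) = 1.
Proof. by rewrite Rintegral_cst// mul1r -[RHS]/(fine 1%E) -(probability_setT P). Qed.

(** The sum equals 1 - u ^ n for n <= k (both are 0 for n = 0)
and 0 for n > k, where 1 - u ^ n lies between 0 and 1. *)
Lemma expX_jump_bounds (k : nat) (u : R) (n : nat) : 0 <= u <= 1 ->
  \sum_(i < k) (1 - u ^+ i.+1) * \1_[set i.+1] n <= 1 - u ^+ n <=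
  \sum_(i < k) (1 - u ^+ i.+1) * \1_[set i.+1] n + \1_[set m | (k < m)%N] n.
Proof.
move=> /andP[u0 u1].
have un1 m : u ^+ m <= 1 by rewrite exprn_ile1.
have [nk|kn] := leqP n k; last first.
  rewrite big1 ?add0r => [|i _]; last first.
    rewrite indicE memNset ?mulr0//= => ni.
    by move: kn; rewrite ni ltnNge ltn_ord.
  rewrite indicE mem_set//=; apply/andP; split; first by rewrite subr_ge0.
  by rewrite gerBl exprn_ge0.
rewrite [X in _ <= _ <= _ + X]indicE memNset/= ?addr0; last first.
  by apply/negP; rewrite -leqNgt.
suff -> : \sum_(i < k) (1 - u ^+ i.+1) * \1_[set i.+1] n = 1 - u ^+ n.
  by rewrite lexx.
case: n nk => [|n] nk.
  rewrite subrr big1// => i _; rewrite indicE memNset ?mulr0//.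
rewrite (bigD1 (Ordinal nk))//= big1 ?addr0.
  by rewrite indicE mem_set// mulr1.
move=> i /eqP/= ni; rewrite indicE memNset ?mulr0// => -[] ni'.
by apply: ni; apply/val_inj.
Qed.

Lemma Rintegral_sum (I : Type) (r : seq I) (F : I -> T -> R) :
  (forall i, P.-integrable setT (EFin \o F i)) ->
  P.-integrable setT (EFin \o (fun w => \sum_(i <- r) F i w)) /\
  \int[P]_w (\sum_(i <- r) F i w) = \sum_(i <- r) \int[P]_w F i w.
Proof.
move=> iF.
have isum s : P.-integrable setT (EFin \o (fun w => \sum_(i <- s) F i w)).
  have -> : EFin \o (fun w => \sum_(i <- s) F i w) =
      (fun w => \sum_(i <- s) (EFin \o F i) w)%E.
    by apply/funext => w /=; rewrite sumEFin.
  exact: integrable_sum.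
split=> //; elim: r => [|i r IHr].
  under eq_Rintegral do rewrite big_nil.
  by rewrite big_nil Rintegral_cst// mul0r.
under eq_Rintegral do rewrite big_cons.
by rewrite big_cons -IHr RintegralD.
Qed.

(** [expX_jump_bounds] in expectation: this is where the jump probabilities of X
enter its generating function. *)
Lemma pgf_jump_bounds X (k : nat) (u : R) :
  measurable_fun setT X -> 0 <= u <= 1 ->
  0 <= 1 - \int[P]_w u ^+ X w
       - \sum_(i < k) (1 - u ^+ i.+1) * fine (P (X @^-1` [set i.+1]))
    <= fine (P (X @^-1` [set m | (k < m)%N])).
Proof.
move=> mX u01; set S := \sum_(i < k) _.
have iterm (i : 'I_k) : P.-integrable setT
    (EFin \o (fun w => (1 - u ^+ i.+1) * \1_[set i.+1] (X w))).
  exact: integrableZl (integrable_indic_nat _ _ mX).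
have [iS SE] := Rintegral_sum _ (index_enum 'I_k) _ iterm.
have {}SE : \int[P]_w (\sum_(i < k) (1 - u ^+ i.+1) * \1_[set i.+1] (X w)) = S.
  rewrite SE; apply: eq_bigr => i _; rewrite RintegralZl//.
    by rewrite Rintegral_indic_nat.
  exact: integrable_indic_nat.
have i1 : P.-integrable setT (EFin \o cst (1 : R)).
  exact: finite_measure_integrable_cst.
have iu := integrable_expX _ _ mX u01.
have iq := integrable_indic_nat X [set m | (k < m)%N] mX.
have i1u : P.-integrable setT (EFin \o (fun w => 1 - u ^+ X w)).
  exact: (integrableB measurableT i1 iu).
rewrite subr_ge0 lerBlDl -[X in X - _]Rintegral1 -RintegralB// -SE -Rintegral_indic_nat//.
rewrite -RintegralD//; apply/andP; split; apply: le_Rintegral => //.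
- by move=> w _; have /andP[] := expX_jump_bounds k _ (X w) u01.
- exact: (integrableD measurableT iS iq).
- by move=> w _; have /andP[] := expX_jump_bounds k _ (X w) u01.
Qed.

End generating_function.

(** * Law of the generalized counting process *)

Section generalized_counting_process.
Context (R : realType) (d : measure_display) (T : measurableType d).
Context (P : probability T R) (k : nat) (lam : 'I_k -> R) (M : nat_process P).
Context (gcpM : generalized_counting_process lam M).

Local Notation pgf u t := (\int[P]_w u ^+ increment M 0 t w).

Let mM t : measurable_fun setT (M t) := measurable_funP (M t).

Let mI s t : measurable_fun setT (increment M s t) :=
  @measurable_increment _ _ _ M s t (mM s) (mM t).

(** Almost surely the path is nondecreasing, so the truncated increments over
[0, s] and [s, s + t] do add up to the increment over [0, s + t]. *)
Lemma gcp_pgfD (u s t : R) : 0 <= u <= 1 -> 0 <= s -> 0 <= t ->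
  pgf u (s + t) = pgf u s * pgf u t.
Proof.
move=> u01 s0 t0; have /andP[u0 u1] := u01.
have mX X : measurable_fun setT X -> measurable_fun setT (fun w : T => u ^+ X w).
  by move=> mX; exact: measurable_nat_comp.
transitivity (\int[P]_w (u ^+ increment M 0 s w * u ^+ increment M s (s + t) w)).
  apply: Rintegral_ae_eq; [exact: mX|by apply: measurable_funM; exact: mX|].
  apply: filterS (gcp_paths gcpM) => w [M0 Mle _].
  rewrite -exprD /increment M0 !subn0 subnKC//.
  by apply: Mle => //; rewrite lerDl.
rewrite (@Rintegral_independentM _ _ _ P _ _ (fun n => u ^+ n) (fun n => u ^+ n) 1)//.
- congr (_ * _); apply: Rintegral_eq_law => // [n|A]; first exact: exprn_ge0.
  exact: (gcp_stationary gcpM).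
- by move=> n; rewrite exprn_ge0//= exprn_ile1.
- by move=> n; rewrite exprn_ge0//= exprn_ile1.
move=> A B.
(* The two intervals [0, s] and [s, s + t] as a subdivision 0 <= s <= s + t. *)
pose tm (n : nat) : R := if n is n'.+1 then if n' is 0 then s else s + t else 0.
have indep : independent_increments M by case: gcpM.
have tm_le i : (i < 2)%N -> tm i <= tm i.+1 by case: i => [|[|]]//= _; rewrite lerDl.
have := indep 2%N tm (lexx _) tm_le (fun i => if i == 0 :> nat then A else B).
rewrite !big_ord_recl big_ord0 mule1/= => <-; congr (P _).
apply/seteqP; split => w /=.
  by move=> [Aw Bw] [[|[|//]] ?].
by move=> AB; split; [exact: (AB ord0)|exact: (AB ord_max)].
Qed.

(** By [pgf_jump_bounds], with D = M h - M 0, the difference 1 - E[u ^ D] is the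
sum of the (1 - u ^ j) P (D = j) over j <= k, up to an error of at most
P (D > k) = o(h). *)
Lemma gcp_pgf_slope (u : R) : 0 <= u <= 1 ->
  (pgf u h - 1) / h @[h --> 0^'+] --> - \sum_(i < k) (1 - u ^+ i.+1) * lam i.
Proof.
move=> u01.
have jrM : jump_rates lam M by case: gcpM.
have [rates tail] := jrM 0 (lexx _).
pose p i h := fine (P (increment M 0 h @^-1` [set (i : 'I_k).+1])).
pose q h := fine (P (increment M 0 h @^-1` [set m | (k < m)%N])).
have pcvg i : p i h / h @[h --> 0^'+] --> lam i.
  have := littleo_right_cvg _ _ (rates i) => pl.
  rewrite -[lam i]add0r.
  apply: cvg_trans (cvgD pl (cvg_cst (lam i))).
  apply: near_eq_cvg; near=> h => /=.
  have h0 : h != 0 by rewrite gt_eqF.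
  rewrite -[LHS]/((fine (P [set w | increment M 0 (0 + h) w = i.+1])
    - lam i * h) / h + lam i) (add0r h) -/(p i h).
  by field.
have qcvg : q h / h @[h --> 0^'+] --> (0 : R).
  suff -> : q = fun h => fine (P [set w | (k < increment M 0 (0 + h) w)%N]).
    exact: littleo_right_cvg tail.
  by apply/funext => h; rewrite add0r.
(* rem h is the contribution of the displacements larger than k. *)
pose rem h := 1 - pgf u h - \sum_(i < k) (1 - u ^+ i.+1) * p i h.
have remcvg : rem h / h @[h --> 0^'+] --> (0 : R).
  apply: squeeze_cvgr (cvg_cst (0 : R)) qcvg; near=> h => /=.
  have h0 : 0 < h by near: h; exact: nbhs_right_gt.
  have /andP[r0 rq] := pgf_jump_bounds _ _ _ P _ k _ (mI 0 h) u01.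
  apply/andP; split; first by rewrite divr_ge0// ltW.
  by rewrite ler_pM2r ?invr_gt0.
have : - (\sum_(i < k) (1 - u ^+ i.+1) * (p i h / h) + rem h / h)
    @[h --> 0^'+] --> - (\sum_(i < k) (1 - u ^+ i.+1) * lam i + 0).
  apply: cvgN; apply: cvgD => //; apply: cvg_big => [|i _]; first exact: add_continuous.
  by apply: cvgM => //; exact: cvg_cst.
rewrite addr0; apply: cvg_trans; apply: near_eq_cvg; near=> h.
under eq_bigr do rewrite mulrA.
by rewrite -mulr_suml -mulrDl /rem addrC subrK -mulNr opprB.
Unshelve. all: by end_near. Qed.

Lemma gcp_pgfE (u t : R) : 0 <= u <= 1 -> 0 < t ->
  \int[P]_w u ^+ M t w = expR (- (\sum_(i < k) (1 - u ^+ i.+1) * lam i) * t).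
Proof.
move=> u01 t0; rewrite -(semigroup_expR _ (fun r => pgf u r) _ _ (gcp_pgf_slope _ u01))//.
  apply: Rintegral_ae_eq; try exact: measurable_nat_comp.
  by apply: filterS (gcp_paths gcpM) => w [M0 _ _]; rewrite /increment M0 subn0.
by move=> s r; exact: gcp_pgfD.
Qed.

(** The exponent of [gcp_pgfE] at u = exp (- a / t) is - \sum_j lam_j times
t (1 - exp (- a j / t)), to which [cvg_expRN_slope] applies. *)
Lemma gcp_laplace_cvg (a : R) : 0 <= a ->
  \int[P]_w expR (- (a / t)) ^+ M t w @[t --> +oo] -->
    expR (- (a * \sum_(i < k) i.+1%:R * lam i)).
Proof.
move=> a0.
have : expR (- \sum_(i < k) t * (1 - expR (- (i.+1%:R * a / t))) * lam i)
    @[t --> +oo] --> expR (- (a * \sum_(i < k) i.+1%:R * lam i)).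
  apply: continuous_cvg; first exact: continuous_expR.
  apply: cvgN; rewrite mulr_sumr; apply: cvg_big => [|i _]; first exact: add_continuous.
  rewrite mulrCA mulrA; apply: cvgM; last exact: cvg_cst.
  by apply: cvg_expRN_slope; rewrite mulr_ge0.
apply: cvg_trans; apply: near_eq_cvg; near=> t.
have t_gt0 : 0 < t by near: t; exact: nbhs_pinfty_gt.
rewrite gcp_pgfE//; last first.
  by rewrite expR_ge0/= -expR0 ler_expR oppr_le0 divr_ge0// ltW.
congr expR; rewrite mulNr mulr_suml; congr (- _); apply: eq_bigr => i _.
by rewrite -expRM_natl mulrN (mulrA _ a); ring.
Unshelve. all: by end_near. Qed.

End generalized_counting_process.

(** * Convergence in probability *)

(** Markov's inequality for the square of Y - exp (- mu), Y = exp (- X / t),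
with the square expanded: (exp (- 2 / t)) ^ X = Y ^ 2. *)
Lemma chebyshev_laplace (R : realType) (d : measure_display)
    (T : measurableType d) (P : probability T R) (X : T -> nat)
    (t mu eps : R) :
  measurable_fun setT X -> 0 < t -> 0 < eps ->
  fine (P [set w | eps <= `|(X w)%:R / t - mu|])
      * (expR (- mu) * (1 - expR (- eps))) ^+ 2 <=
  \int[P]_w expR (- (2 / t)) ^+ X w
  - 2 * expR (- mu) * \int[P]_w expR (- (1 / t)) ^+ X w + expR (- mu) ^+ 2.
Proof.
move=> mX t0 e0; set c := expR (- mu); set del := c * _.
pose A := [set n : nat | eps <= `|n%:R / t - mu|].
have e01 a : 0 <= a -> 0 <= expR (- (a / t)) <= 1.
  move=> a0; rewrite expR_ge0/= -expR0 ler_expR oppr_le0.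
  by rewrite divr_ge0// ltW.
have iA := integrable_indic_nat _ _ _ P X A mX.
have i1 := integrable_expX _ _ _ P X _ mX (e01 1 ler01).
have i2 := integrable_expX _ _ _ P X _ mX (e01 2 (ler0n _ _)).
have ic : P.-integrable setT (EFin \o cst (c ^+ 2)).
  exact: finite_measure_integrable_cst.
have iZ := integrableZl measurableT (2 * c) i1.
have iB := integrableB measurableT i2 iZ.
have -> : \int[P]_w expR (- (2 / t)) ^+ X w
    - 2 * c * \int[P]_w expR (- (1 / t)) ^+ X w + c ^+ 2 =
  \int[P]_w (expR (- (2 / t)) ^+ X w - 2 * c * expR (- (1 / t)) ^+ X w + c ^+ 2).
  rewrite (RintegralD measurableT iB ic) (RintegralB measurableT i2 iZ).
  rewrite (RintegralZl _ measurableT i1) Rintegral_cst//.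
  by rewrite -[in LHS](mulr1 (c ^+ 2)) -(Rintegral1 _ _ _ P) Rintegral_cst// mul1r.
rewrite mulrC -(Rintegral_indic_nat _ _ _ P X A mX) -RintegralZl//.
apply: le_Rintegral => //.
- exact: (integrableZl measurableT _ iA).
- exact: (integrableD measurableT iB ic).
move=> w _.
have -> : expR (- (2 / t)) ^+ X w - 2 * c * expR (- (1 / t)) ^+ X w + c ^+ 2
    = (expR (- ((X w)%:R / t)) - c) ^+ 2.
  have -> : expR (- (1 / t)) ^+ X w = expR (- ((X w)%:R / t)).
    by rewrite -expRM_natl; congr expR; ring.
  have -> : expR (- (2 / t)) ^+ X w = expR (- ((X w)%:R / t)) ^+ 2.
    by rewrite -!expRM_natl; congr expR; ring.
  by ring.
rewrite indicE; have [XA|_] := boolP (X w \in A); last by rewrite mulr0 sqr_ge0.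
rewrite mulr1 -[leRHS]real_normK ?num_real// lerXn2r ?nnegrE//.
  by rewrite mulr_ge0 ?expR_ge0// subr_ge0 -expR0 ler_expR oppr_le0 ltW.
by apply: expRN_dist => //; rewrite inE in XA.
Qed.

Theorem lemma3p1 (R : realType) (d : measure_display) (T : measurableType d)
    (P : probability T R) (k : nat) (lam : 'I_k -> R) (M : nat_process P) :
  (1 <= k)%N ->
  (forall j : 'I_k, 0 < lam j) ->
  generalized_counting_process lam M ->
  cvg_in_probability P (fun t w => (M t w)%:R / t)
    (\sum_(j < k) j.+1%:R * lam j).
Proof.
move=> _ _ gcpM eps eps0; set mu := \sum_(j < k) _.
pose dev t := [set w | eps <= `|(M t w)%:R / t - mu|].
pose del := expR (- mu) * (1 - expR (- eps)).
have del0 : 0 < del ^+ 2.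
  by rewrite exprn_gt0// mulr_gt0 ?expR_gt0// subr_gt0 -expR0 ltr_expR oppr_lt0.
have mM t : measurable_fun setT (M t) by exact: measurable_funP.
pose E2 t := \int[P]_w expR (- (2 / t)) ^+ M t w
  - 2 * expR (- mu) * \int[P]_w expR (- (1 / t)) ^+ M t w + expR (- mu) ^+ 2.
have E2cvg : E2 t @[t --> +oo] --> (0 : R).
  have -> : (0 : R) = expR (- (2 * mu)) - 2 * expR (- mu) * expR (- (1 * mu))
      + expR (- mu) ^+ 2.
    by rewrite mul1r -mulrN expRM_natl; ring.
  apply: cvgD; last exact: cvg_cst.
  apply: cvgB; first exact: (gcp_laplace_cvg _ _ _ _ _ _ _ gcpM).
  apply: cvgM; first exact: cvg_cst.
  exact: (gcp_laplace_cvg _ _ _ _ _ _ _ gcpM).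
have finP : fine (P (dev t)) @[t --> +oo] --> (0 : R).
  have bcvg : E2 t / del ^+ 2 @[t --> +oo] --> (0 : R).
    by rewrite -[X in _ --> X](mul0r (del ^+ 2)^-1); apply: cvgM => //; exact: cvg_cst.
  apply: squeeze_cvgr (cvg_cst (0 : R)) bcvg; near=> t.
  have t0 : 0 < t by near: t; exact: nbhs_pinfty_gt.
  rewrite fine_ge0//= ler_pdivlMr//.
  exact: chebyshev_laplace.
have mdev t : measurable (dev t).
  exact: (measurable_nat_preimage _ _ _ [set n : nat | eps <= `|n%:R / t - mu|] (mM t)).
by apply: cvg_EFin finP; near=> t; exact: fin_num_measure.
Unshelve. all: by end_near. Qed.
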